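(* Let $f:\mathbb{R}^n\to\mathbb{R}$ be a continuously differentiable, $\gamma$-strongly quasiconvex function with modulus $\gamma>0$, and let $x^*=\mathrm{argmin}_{\mathbb{R}^n} f$. Suppose that there exists a constant $\kappa>0$ such that $$\langle \nabla f(x),x-x^*\rangle \ge \kappa\,(f(x)-f(x^* ))\quad\text{for all } x\in\mathbb{R}^n .$$ Let $$\alpha\in\left(0,\ \frac{\kappa+4}{4}\sqrt{\frac{\gamma}{\kappa}}\right],\qquad \beta\in\left[0,\ \frac{\sqrt{\alpha^2(\kappa+2)^4+16\gamma(\kappa+4)^3}-\alpha(\kappa+2)^2}{4\gamma(\kappa+4)}\right],$$ and let $x:[t_0,+\infty)\to\mathbb{R}^n$ be a solution of $$\ddot{x}(t)+\alpha\dot{x}(t)+\nabla f\big(x(t)+\beta\dot{x}(t)\big)=0 .$$ Then, as $t\to+\infty$, $$f(x(t)+\beta\dot{x}(t))-f(x^* )=\mathcal{O}\big(e^{-\frac{\alpha\kappa}{\kappa+4}t}\big),\qquad \|x(t)-x^*\|=\mathcal{O}\big(e^{-\frac{\alpha\kappa}{2(\kappa+4)}t}\big),\qquad \|\dot{x}(t)\|=\mathcal{O}\big(e^{-\frac{\alpha\kappa}{2(\kappa+4)}t}\big).$$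
   Context: $\mathbb{R}^n$ carries the Euclidean inner product $\langle\cdot,\cdot\rangle$ and norm $\|\cdot\|$. A function $f:\mathbb{R}^n\to\mathbb{R}$ is $\gamma$-strongly quasiconvex with modulus $\gamma>0$ if for all $x,y\in\mathbb{R}^n$ and $\lambda\in[0,1]$, $f(\lambda y+(1-\lambda)x)\le\max\{f(y),f(x)\}-\lambda(1-\lambda)\frac{\gamma}{2}\|x-y\|^2$. A lower semicontinuous $\gamma$-strongly quasiconvex function on $\mathbb{R}^n$ has a unique minimizer, so $x^*=\mathrm{argmin}_{\mathbb{R}^n}f$ denotes that point. $t_0\in\mathbb{R}$ is the initial time; a solution is a twice continuously differentiable function on $[t_0,+\infty)$ satisfying the equation for all $t\ge t_0$. *)

(* Defs.v *)
From HB Require Import structures.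
From mathcomp Require Import all_boot all_order all_algebra.
From mathcomp Require Import all_classical all_reals all_analysis.
Set Implicit Arguments.
Unset Strict Implicit.
Unset Printing Implicit Defensive.
Import Order.TTheory GRing.Theory Num.Theory.
Import numFieldNormedType.Exports.
Local Open Scope classical_set_scope.
Local Open Scope ring_scope.

(* Lets the library's Landau notation be used along the filter +oo. *)
Canonical pinfty_filter_on (R : numFieldType) :=
  FilterType (pinfty_nbhs R) (@proper_pinfty_nbhs R).

(* The library norm `|_| on 'rV[R]_n is the sup norm, hence a separate
   Euclidean norm; both induce the same topology, so limits, continuity and
   differentiability on 'rV[R]_n are the library's. *)
Definition dotv (R : realType) (n : nat) (u v : 'rV[R]_n) : R :=
  \sum_(i < n) u 0 i * v 0 i.

Definition enorm (R : realType) (n : nat) (u : 'rV[R]_n) : R :=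
  Num.sqrt (dotv u u).

Definition grad (R : realType) (n : nat) (f : 'rV[R]_n -> R) (x : 'rV[R]_n) :
    'rV[R]_n :=
  \row_(i < n) 'D_(delta_mx 0 i) f x.

Definition continuously_differentiable (R : realType) (n : nat)
    (f : 'rV[R]_n -> R) : Prop :=
  (forall x, differentiable f x) /\ continuous (grad f).

Definition strongly_quasiconvex (R : realType) (n : nat) (gamma : R)
    (f : 'rV[R]_n -> R) : Prop :=
  forall (x y : 'rV[R]_n) (lambda : R), 0 <= lambda <= 1 ->
    f (lambda *: y + (1 - lambda) *: x) <=
      Num.max (f y) (f x)
      - lambda * (1 - lambda) * (gamma / 2) * enorm (x - y) ^+ 2.

Definition argmin (R : realType) (n : nat) (f : 'rV[R]_n -> R) :
    set 'rV[R]_n :=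
  [set x | forall y, f x <= f y].

(* Derivative of a curve relative to a time set D: the difference quotient at t
   only uses times in D, so for D = [t0, +oo[ it is the right derivative at t0
   and the ordinary derivative at t > t0. *)
Definition diff_quot (R : realType) (n : nat) (x : R -> 'rV[R]_n) (t : R) :
    R -> 'rV[R]_n :=
  fun s => (s - t)^-1 *: (x s - x t).

Definition derivable_in (R : realType) (n : nat) (D : set R)
    (x : R -> 'rV[R]_n) (t : R) : Prop :=
  cvg (diff_quot x t @ within D t^').

Definition derive_in (R : realType) (n : nat) (D : set R)
    (x : R -> 'rV[R]_n) (t : R) : 'rV[R]_n :=
  lim (diff_quot x t @ within D t^').

Definition twice_continuously_differentiable_in (R : realType) (n : nat)
    (D : set R) (x : R -> 'rV[R]_n) : Prop :=
  [/\ forall t, D t -> derivable_in D x t,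
      forall t, D t -> derivable_in D (derive_in D x) t
    & {within D, continuous (derive_in D (derive_in D x))}].

Definition is_solution (R : realType) (n : nat) (f : 'rV[R]_n -> R)
    (alpha beta t0 : R) (x : R -> 'rV[R]_n) : Prop :=
  let D := `[t0, +oo[%classic in
  let x' := derive_in D x in
  let x'' := derive_in D x' in
  twice_continuously_differentiable_in D x /\
  forall t, t0 <= t ->
    x'' t + alpha *: x' t + grad f (x t + beta *: x' t) = 0.

(* Main.v *)
Require Import Defs.
From HB Require Import structures.
From mathcomp Require Import all_boot all_order all_algebra.
From mathcomp Require Import all_classical all_reals all_analysis.
From mathcomp Require Import ring lra.
Set Implicit Arguments.
Unset Strict Implicit.
Unset Printing Implicit Defensive.
Import Order.TTheory GRing.Theory Num.Theory.
Import numFieldNormedType.Exports.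
Local Open Scope classical_set_scope.
Local Open Scope ring_scope.

(** The damped system is controlled by the energy
    [E = f y - f xs + 1/2 |w|^2 + 2 delta^2 |u|^2], where [y = x + beta x'],
    [u = x - xs], [w = 2 delta u + x'] and [delta = alpha / (kappa + 4)].
    The shift [2 delta] and the weight of [|u|^2] are chosen so that the mixed
    terms [<u, x'>] cancel in [E' + kappa delta E].

    What remains is nonpositive for the following reasons.  The ODE turns
    [E'] into an expression containing [- 2 delta <grad f y, y - xs>].  One half
    of it is estimated by the hypothesis on [kappa] and absorbs
    [kappa delta (f y - f xs)]; the other half is estimated by strong
    quasiconvexity, which gives
    [<grad f y, y - xs> >= gamma/2 |y - xs|^2] ([strongly_quasiconvex_grad]).
    As [|y - xs|^2 = |u + beta x'|^2 >= |u|^2/2 - beta^2 |x'|^2], this leaves a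
    multiple of [|u|^2] whose sign is governed by the bound on [alpha], and a
    multiple of [|x'|^2] whose sign is governed by the bound on [beta]: the
    upper bound on [beta] is the positive root of the quadratic
    [2 gamma beta^2 + delta (kappa + 2)^2 beta - 2 (kappa + 4)].
    This computation is [energy_dissipation].

    Hence [E' <= - kappa delta E], so [E] decays like [exp (- kappa delta t)]
    ([exponential_decay]); [f y - f xs], [2 delta^2 |u|^2] and [|x'|^2 / 4] are
    all bounded by [E], which gives the three rates.  Since the rates only
    concern large times, everything happens on [t > t0], where the derivatives
    relative to [[t0, +oo[] are ordinary derivatives. *)

(** * Euclidean inner product *)

Section DotProduct.
Context {R : realType} {n : nat}.
Implicit Types (u v w : 'rV[R]_n) (a : R).

Lemma dotvC u v : dotv u v = dotv v u.
Proof. by apply: eq_bigr => i _; rewrite mulrC. Qed.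

Lemma dotvDr u v w : dotv u (v + w) = dotv u v + dotv u w.
Proof. by rewrite -big_split; apply: eq_bigr => i _; rewrite mxE mulrDr. Qed.

Lemma dotvZr a u v : dotv u (a *: v) = a * dotv u v.
Proof. by rewrite mulr_sumr; apply: eq_bigr => i _; rewrite mxE mulrCA. Qed.

Lemma dotvDl u v w : dotv (v + w) u = dotv v u + dotv w u.
Proof. by rewrite dotvC dotvDr !(dotvC u). Qed.

Lemma dotvZl a u v : dotv (a *: v) u = a * dotv v u.
Proof. by rewrite dotvC dotvZr dotvC. Qed.

Lemma dotvv_ge0 u : 0 <= dotv u u.
Proof. by apply: sumr_ge0 => i _; rewrite -expr2 sqr_ge0. Qed.

Lemma enorm_sqr u : enorm u ^+ 2 = dotv u u.
Proof. by rewrite sqr_sqrtr ?dotvv_ge0. Qed.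

End DotProduct.

(** * Differentiation along curves *)

Section Derivatives.
Context {R : realType} {n : nat}.

Lemma is_derive_dotv (a b : R -> 'rV[R]_n) (a' b' : 'rV[R]_n) (t : R) :
  is_derive t 1 a a' -> is_derive t 1 b b' ->
  is_derive t 1 (fun s => dotv (a s) (b s)) (dotv a' (b t) + dotv (a t) b').
Proof.
have coord (c : R -> 'rV[R]_n) c' : is_derive t 1 c c' ->
    forall i, is_derive t 1 (fun s => c s 0 i) (c' 0 i).
  move=> [dc <-] i; split; first exact: (derivable_mxP _ _ _).1.
  by rewrite derive_mx// mxE.
move=> /coord da /coord db.
have := is_derive_sum (fun i => is_deriveM (da i) (db i)).
rewrite (_ : \sum_(i < n) _ = (fun s => dotv (a s) (b s))); last first.
  by apply/funext => s; rewrite fct_sumE.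
rewrite (_ : \sum_(i < n) _ = dotv a' (b t) + dotv (a t) b')//.
rewrite -big_split; apply: eq_bigr => i _ /=.
by rewrite addrC /GRing.scale /= [b t 0 i * _]mulrC.
Qed.

Lemma derive_grad (f : 'rV[R]_n -> R) (p d : 'rV[R]_n) :
  differentiable f p -> 'D_d f p = dotv (grad f p) d.
Proof.
move=> df; rewrite deriveE// {1}(row_sum_delta d) linear_sum.
by apply: eq_bigr => i _; rewrite linearZ/= mxE deriveE// mulrC.
Qed.

Lemma is_derive_comp_grad (f : 'rV[R]_n -> R) (y : R -> 'rV[R]_n)
    (y' : 'rV[R]_n) (t : R) :
  differentiable f (y t) -> is_derive t 1 y y' ->
  is_derive t 1 (f \o y) (dotv (grad f (y t)) y').
Proof.
move=> df [dy <-].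
have dy' : differentiable y t by exact/derivable1_diffP.
have dfy : differentiable (f \o y) t by exact: differentiable_comp.
split; first exact/derivable1_diffP.
by rewrite deriveE// diff_comp//= -deriveE// -deriveE// derive_grad.
Qed.

(** Near an interior point the restriction of times to [D] is void; the
    library's increments [h] and the times [s = t + h] differ by a shift. *)
Lemma derive_in_interior (D : set R) (x : R -> 'rV[R]_n) (t : R) :
  D° t -> derivable_in D x t -> is_derive t 1 x (derive_in D x t).
Proof.
move=> Dt dx.
have dxt : diff_quot x t @ t^' --> derive_in D x t.
  apply: cvg_trans dx => A /= dA.
  have Dt' : \forall s \near t^', D s by exact: (@nbhs_dnbhs _ t) _ Dt.
  by apply: filterS2 Dt' dA => s Ds; exact.
have shift_cvg :
    (fun h => h^-1 *: ((x \o shift t) (h *: 1) - x t)) @ 0^' -->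
    derive_in D x t.
  rewrite (_ : (fun h => _) = diff_quot x t \o shift t); last first.
    by apply/funext => h /=; rewrite /diff_quot addrK /GRing.scale /= mulr1.
  apply: cvg_comp dxt => A /=.
  rewrite /dnbhs /within /= => tA.
  have /nbhsDl : \forall z \near 0 + t, z != t -> A z by rewrite add0r.
  by apply: filterS => h /= Ah h0; apply: Ah; rewrite -subr_eq0 addrK.
split; last exact: cvg_lim shift_cvg.
by apply/cvg_ex; exists (derive_in D x t).
Qed.

End Derivatives.

(** * Strong quasiconvexity, first order *)

(** For small [s > 0], strong quasiconvexity bounds the difference quotient of
    [f] at [p] in the direction [q - p] by
    [- (1 - s) * gamma / 2 * |p - q|^2]; let [s] tend to [0]. *)
Lemma strongly_quasiconvex_grad (R : realType) (n : nat) (gamma : R)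
    (f : 'rV[R]_n -> R) (p q : 'rV[R]_n) :
  strongly_quasiconvex gamma f -> differentiable f p -> f q <= f p ->
  gamma / 2 * dotv (p - q) (p - q) <= dotv (grad f p) (p - q).
Proof.
move=> sqc df fqp.
set c := gamma / 2 * _.
have dfd : derivable f p (q - p) by exact: diff_derivable.
have key : 'D_(q - p) f p <= - c.
  have c_cvg : (s - 1) * c @[s --> (0 : R)^'+] --> (0 - 1) * c.
    apply: cvgMl; apply: cvgB; last exact: cvg_cst.
    exact: cvg_at_right_filter.
  rewrite -[leRHS]mulN1r -[- 1]add0r.
  apply: (ler_cvg_to (cvg_dnbhs_at_right dfd) c_cvg).
  near=> s.
  have s0 : 0 < s by [].
  have s1 : s <= 1 by near: s; exact: nbhs_right_le.
  have := sqc p q s.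
  rewrite ltW// s1 => /(_ isT).
  rewrite max_r// enorm_sqr => fs.
  rewrite /= /GRing.scale /= mulrC ler_pdivrMr//.
  have -> : s *: (q - p) + p = s *: q + (1 - s) *: p.
    by rewrite scalerBr scalerBl scale1r addrA addrAC.
  rewrite lerBlDl (le_trans fs)// /c; lra.
by rewrite derive_grad// -opprB -scaleN1r dotvZr mulN1r lerNl opprK in key.
Unshelve. all: by end_near. Qed.

(** * Exponential decay *)

Lemma enorm_bigO_expR (R : realType) (n : nat) (w : R -> 'rV[R]_n)
    (C r : R) :
  (\forall t \near +oo, dotv (w t) (w t) <= C * expR (- r * t)) ->
  (fun t => enorm (w t)) =O_ +oo (fun t => expR (- (r / 2) * t)).
Proof.
(* The constant works because C <= (|C| + 1)^2. *)
move=> wC; apply/eqO_exP; exists (`|C| + 1); first by rewrite ltr_wpDl.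
near=> t.
rewrite ger0_norm ?sqrtr_ge0// (gtr0_norm (expR_gt0 _)).
have k0 : 0 <= `|C| + 1 by rewrite addr_ge0.
rewrite -ler_sqr ?nnegrE ?sqrtr_ge0 ?mulr_ge0 ?expR_ge0//.
rewrite enorm_sqr.
have wt : dotv (w t) (w t) <= C * expR (- r * t) by near: t.
apply: (le_trans wt).
rewrite exprMn -expRM_natl (_ : 2%:R * _ = - r * t); last by field.
rewrite ler_pM2r ?expR_gt0// (le_trans (ler_norm C))//.
have := normr_ge0 C; nra.
Unshelve. all: by end_near. Qed.

(** Gronwall: [E t * expR (r * t)] is nonincreasing.  The base point [b] lies
    strictly inside [t > a], so that nothing is asked of [E] at [a]. *)
Lemma exponential_decay (R : realType) (E dE : R -> R) (a b r : R) :
  (forall t, a < t -> is_derive t 1 E (dE t)) ->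
  (forall t, a < t -> dE t <= - r * E t) -> a < b ->
  forall t, b <= t -> E t <= E b * expR (r * b) * expR (- r * t).
Proof.
move=> EdE decay ab t bt.
pose G s := E s * expR (r * s).
have dG s : a < s -> is_derive s 1 G ((dE s + r * E s) * expR (r * s)).
  move=> /EdE ?; apply: is_derive_eq.
  rewrite /GRing.scale /=; ring.
have aE s : b < s -> a < s by exact: lt_trans.
have : G t <= G b.
  apply: (@ler0_derive1_nincry _ G b) => //.
  - by move=> s; rewrite in_itv/= andbT => /aE/dG[].
  - move=> s; rewrite in_itv/= andbT => /aE as_.
    rewrite derive1E (@derive_val _ _ _ _ _ _ _ (dG _ as_)).
    rewrite mulr_le0_ge0 ?expR_ge0//.
    by have := decay s as_; lra.
  - apply: derivable_within_continuous => s; rewrite in_itv/= andbT => bs.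
    by have [] := dG s (lt_le_trans ab bs).
by rewrite /G mulNr expRN ler_pdivlMr ?expR_gt0.
Qed.

(** * The energy estimate *)

(** Pointwise form of [E' <= - kappa delta E]: [u], [v], [dv] are the values of
    [x - xs], [x'], [x''], [g] is [grad f y], [F] is [f y - f xs], and the
    left-hand side is [E'].  The difference of the two sides is a combination
    of the two lower bounds on [<g, y>], of the squares [|u + 2 beta v|^2]
    (which separates [u] from [v] in [|y|^2]) and
    [|g + (kappa + 2) delta / 2 v|^2] (which absorbs the mixed term [<g, v>]
    into [beta |g|^2]), and of [|u|^2] and [|v|^2] with the slacks of the two
    parameter conditions as coefficients. *)
Lemma energy_dissipation (R : realType) (n : nat)
    (gamma kappa delta beta F : R) (u v g : 'rV[R]_n) :
  let y := u + beta *: v in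
  let w := (2 * delta) *: u + v in
  let dv := - (((kappa + 4) * delta) *: v) - g in
  0 <= gamma -> 0 <= delta -> 0 <= beta ->
  16 * kappa * delta ^+ 2 <= gamma ->
  2 * gamma * beta ^+ 2 + delta * (kappa + 2) ^+ 2 * beta
    <= 2 * (kappa + 4) ->
  kappa * F <= dotv g y -> gamma / 2 * dotv y y <= dotv g y ->
  dotv g (v + beta *: dv) + dotv w ((2 * delta) *: v + dv)
    + 4 * delta ^+ 2 * dotv u v
  <= - (kappa * delta)
     * (F + 2^-1 * dotv w w + 2 * delta ^+ 2 * dotv u u).
Proof.
move=> y w dv gamma0 d0 b0 alphaB betaB gF gy.
have := dotvv_ge0 (g + ((kappa + 2) * delta / 2) *: v).
have := dotvv_ge0 (u + (2 * beta) *: v).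
have uu0 := dotvv_ge0 u; have vv0 := dotvv_ge0 v.
move: gF gy; rewrite /y /w /dv -(scaleN1r g) -(scaleN1r (_ *: v)).
rewrite !(dotvDl, dotvDr, dotvZl, dotvZr).
rewrite (dotvC v u) (dotvC v g) (dotvC u g).
move: (dotv u u) (dotv v v) (dotv u v) (dotv g u) (dotv g v) (dotv g g) uu0 vv0.
move=> uu vv uv gu gv gg uu0 vv0 gF gy sq1 sq2.
have p1 : 0 <= delta * (gu + beta * gv - kappa * F).
  by apply: mulr_ge0 => //; lra.
have p2 : 0 <= delta * (gu + beta * gv
    - gamma / 2 * (uu + 2 * beta * uv + beta ^+ 2 * vv)).
  by apply: mulr_ge0 => //; lra.
have {}sq2 : 0 <= beta * (gg + (kappa + 2) * delta * gv
    + ((kappa + 2) * delta / 2) ^+ 2 * vv).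
  by apply: mulr_ge0 => //; lra.
have {}sq1 : 0 <= delta * gamma * (uu + 4 * beta * uv + 4 * beta ^+ 2 * vv).
  by apply: mulr_ge0; [exact: mulr_ge0|lra].
have p3 : 0 <= delta * (gamma - 16 * kappa * delta ^+ 2) * uu.
  by rewrite mulr_ge0// mulr_ge0// subr_ge0.
have p4 : 0 <= delta * (2 * (kappa + 4)
    - (2 * gamma * beta ^+ 2 + delta * (kappa + 2) ^+ 2 * beta)) * vv.
  by rewrite mulr_ge0// mulr_ge0// subr_ge0.
lra.
Qed.

(** * Convergence rates *)

Theorem theorem3p1 (R : realType) (n : nat) (f : 'rV[R]_n -> R)
    (gamma kappa alpha beta t0 : R) (xs : 'rV[R]_n) (x : R -> 'rV[R]_n)
    (gamma_gt0 : 0 < gamma)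
    (f_C1 : continuously_differentiable f)
    (f_sqc : strongly_quasiconvex gamma f)
    (xs_argmin : argmin f = [set xs])
    (kappa_gt0 : 0 < kappa)
    (f_kappa : forall z : 'rV[R]_n,
       kappa * (f z - f xs) <= dotv (grad f z) (z - xs))
    (alpha_bnd : 0 < alpha <= (kappa + 4) / 4 * Num.sqrt (gamma / kappa))
    (beta_bnd : 0 <= beta <=
       (Num.sqrt (alpha ^+ 2 * (kappa + 2) ^+ 4 + 16 * gamma * (kappa + 4) ^+ 3)
        - alpha * (kappa + 2) ^+ 2) / (4 * gamma * (kappa + 4)))
    (x_sol : is_solution f alpha beta t0 x) :
  let x' := derive_in `[t0, +oo[ x in
  [/\ (fun t => f (x t + beta *: x' t) - f xs)
        =O_ +oo (fun t => expR (- (alpha * kappa / (kappa + 4)) * t)),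
      (fun t => enorm (x t - xs))
        =O_ +oo (fun t => expR (- (alpha * kappa / (2 * (kappa + 4))) * t))
    & (fun t => enorm (x' t))
        =O_ +oo (fun t => expR (- (alpha * kappa / (2 * (kappa + 4))) * t))].
Proof.
move=> x'.
pose D := `[t0, +oo[%classic.
have [[x_der x'_der _] ode] := x_sol.
pose x'' := derive_in D x'.
have intD t : t0 < t -> D° t.
  by move=> t0t; rewrite /D interior_itv/= in_itv/= andbT.
have inD t : t0 < t -> D t.
  by move=> t0t; rewrite /D/= in_itv/= andbT ltW.
have dx t : t0 < t -> is_derive t 1 x (x' t).
  by move=> t0t; apply: derive_in_interior; [exact: intD|exact/x_der/inD].
have dx' t : t0 < t -> is_derive t 1 x' (x'' t).
  by move=> t0t; apply: derive_in_interior; [exact: intD|exact/x'_der/inD].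
have xs_min p : f xs <= f p.
  have : argmin f xs by rewrite xs_argmin.
  exact.
case/andP: alpha_bnd => alpha0 alphaB; case/andP: beta_bnd => beta0 betaB.
have k4 : 0 < kappa + 4 by lra.
pose delta := alpha / (kappa + 4).
have delta0 : 0 < delta by exact: divr_gt0.
have alphaE : alpha = (kappa + 4) * delta by rewrite /delta mulrC divfK ?gt_eqF.
have deltaB : 16 * kappa * delta ^+ 2 <= gamma.
  have d4 : 4 * delta <= Num.sqrt (gamma / kappa).
    by rewrite -(ler_pM2l k4); lra.
  have gk0 : 0 <= gamma / kappa by rewrite divr_ge0// ltW.
  have d40 : 0 <= 4 * delta by lra.
  have : (4 * delta) ^+ 2 <= gamma / kappa.
    by rewrite -[leRHS]sqr_sqrtr// ler_sqr ?nnegrE ?sqrtr_ge0.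
  by rewrite ler_pdivlMr//; lra.
have betaB' : 2 * gamma * beta ^+ 2 + delta * (kappa + 2) ^+ 2 * beta
    <= 2 * (kappa + 4).
  set disc := alpha ^+ 2 * _ + _ in betaB.
  have gk4 : 0 < 4 * gamma * (kappa + 4) by rewrite !mulr_gt0.
  have disc0 : 0 <= disc.
    by rewrite /disc addr_ge0// mulr_ge0 ?exprn_ge0//; lra.
  have lhs0 : 0 <= beta * (4 * gamma * (kappa + 4)) + alpha * (kappa + 2) ^+ 2.
    by rewrite addr_ge0// mulr_ge0 ?sqr_ge0// ltW.
  (* Squaring the bound on beta and dividing by 8 gamma (kappa + 4)^2 leaves
     the quadratic inequality. *)
  have : (beta * (4 * gamma * (kappa + 4)) + alpha * (kappa + 2) ^+ 2) ^+ 2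
      <= disc.
    rewrite -[leRHS]sqr_sqrtr// ler_sqr ?nnegrE ?sqrtr_ge0//.
    by rewrite ler_pdivlMr// in betaB; lra.
  rewrite /disc alphaE => sqB.
  have c0 : 0 < 8 * gamma * (kappa + 4) ^+ 2 by rewrite !mulr_gt0// exprn_gt0.
  by rewrite -(ler_pM2l c0); lra.
pose y t := x t + beta *: x' t.
pose u t := x t - xs.
pose w t := (2 * delta) *: u t + x' t.
pose E t := f (y t) - f xs + 2^-1 * dotv (w t) (w t)
  + 2 * delta ^+ 2 * dotv (u t) (u t).
pose dE t := dotv (grad f (y t)) (x' t + beta *: x'' t)
  + dotv (w t) ((2 * delta) *: x' t + x'' t)
  + 4 * delta ^+ 2 * dotv (u t) (x' t).
have EdE t : t0 < t -> is_derive t 1 E (dE t).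
  move=> t0t; have xt := dx t t0t; have x't := dx' t t0t.
  have yt : is_derive t 1 y (x' t + beta *: x'' t) by exact: is_deriveD.
  have ut : is_derive t 1 u (x' t).
    by apply: is_derive_eq; rewrite subr0.
  have wt : is_derive t 1 w ((2 * delta) *: x' t + x'' t) by exact: is_deriveD.
  have fyt := is_derive_comp_grad (f_C1.1 (y t)) yt.
  have wwt := is_derive_dotv wt wt.
  have uut := is_derive_dotv ut ut.
  have := is_deriveD (is_deriveD (is_deriveB fyt (is_derive_cst (f xs) t 1))
    (is_deriveZ 2^-1 wwt)) (is_deriveZ (2 * delta ^+ 2) uut).
  rewrite -[X in is_derive _ _ X _]/E => Et; apply: (is_derive_eq Et).
  rewrite /dE subr0 /GRing.scale/= (dotvC (x' t) (u t)).
  by rewrite (dotvC _ (w t)); field.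
have decay t : t0 < t -> dE t <= - (kappa * delta) * E t.
  move=> t0t.
  have x''E : x'' t = - (((kappa + 4) * delta) *: x' t) - grad f (y t).
    have := ode t (ltW t0t); rewrite -alphaE => /eqP.
    by rewrite -addrA addr_eq0 opprD => /eqP.
  have yE : u t + beta *: x' t = y t - xs by rewrite /u /y addrAC.
  rewrite /dE x''E.
  apply: (@energy_dissipation _ _ gamma) => //;
    rewrite ?(ltW gamma_gt0) ?(ltW delta0)// yE.
    exact: f_kappa.
  exact: strongly_quasiconvex_grad f_sqc (f_C1.1 _) (xs_min _).
have t0_lt : t0 < t0 + 1 by rewrite ltrDl.
have := exponential_decay EdE decay t0_lt.
set C := E _ * _ => EC.
have F0 t : 0 <= f (y t) - f xs by rewrite subr_ge0.
have rE : kappa * delta = alpha * kappa / (kappa + 4).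
  by rewrite /delta mulrA (mulrC kappa).
have rE2 : alpha * kappa / (2 * (kappa + 4)) = kappa * delta / 2.
  by rewrite rE; field; rewrite gt_eqF.
have ww0 t := dotvv_ge0 (w t).
have uu0 t := dotvv_ge0 (u t).
have late : \forall t \near +oo, t0 + 1 <= t
  by apply: nbhs_pinfty_ge; exact: num_real.
have d2uu t : 0 <= 2 * delta ^+ 2 * dotv (u t) (u t).
  by rewrite mulr_ge0// mulr_ge0// sqr_ge0.
split.
- apply/eqO_exP; exists (`|C| + 1); first by rewrite ltr_wpDl.
  near=> t.
  have tt : t0 + 1 <= t by near: t.
  rewrite (ger0_norm (F0 t)) (gtr0_norm (expR_gt0 _)) -rE.
  apply: (@le_trans _ _ (E t)).
    by rewrite /E; have := ww0 t; have := d2uu t; lra.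
  apply: (le_trans (EC t tt)).
  by rewrite ler_pM2r ?expR_gt0// (le_trans (ler_norm C))// lerDl.
- rewrite rE2; apply: (@enorm_bigO_expR _ _ _ (C / (2 * delta ^+ 2))).
  near=> t.
  have tt : t0 + 1 <= t by near: t.
  have dd0 : 0 < 2 * delta ^+ 2 by rewrite mulr_gt0// exprn_gt0.
  rewrite mulrAC ler_pdivlMr// mulrC.
  apply: le_trans (EC t tt).
  by rewrite /E; have := ww0 t; have := F0 t; lra.
- rewrite rE2; apply: (@enorm_bigO_expR _ _ _ (4 * C)).
  near=> t.
  have tt : t0 + 1 <= t by near: t.
  rewrite -mulrA; apply: (@le_trans _ _ (4 * E t)); last first.
    by rewrite ler_pM2l// EC.
  (* 4 E - |x'|^2 = 4 (f y - f xs) + |4 delta u + x'|^2. *)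
  have := dotvv_ge0 ((4 * delta) *: u t + x' t); have := F0 t.
  rewrite /E /w; move: (f (y t) - f xs) (u t) (x' t) => F p q F_ge0.
  by rewrite !(dotvDl, dotvDr, dotvZl, dotvZr) (dotvC q p); lra.
Unshelve. all: by end_near. Qed.
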